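(* Assume $\lim_{j\to\infty} a_j=\infty$. Then EXP-weak tractability of integration in the spaces $\mathcal{H}_{d,\boldsymbol{a},\boldsymbol{b}}$ is achieved by lattice rules, and even by Korobov lattice rules. That is, for $\varepsilon\in(0,1)$ and $d\in\mathbb{N}$ let $$N^{\mathrm{lat}}(\varepsilon,d)=\min\{N\in\mathbb{N} : \exists\, \boldsymbol{g}\in G_N^d \text{ with } e(\mathcal{H}_{d,\boldsymbol{a},\boldsymbol{b}},\mathcal{P}(\boldsymbol{g},N))\le\varepsilon\},$$ $$N^{\mathrm{kor}}(\varepsilon,d)=\min\{N\in\mathbb{N} : \exists\, g\in G_N \text{ with } e(\mathcal{H}_{d,\boldsymbol{a},\boldsymbol{b}},\mathcal{P}(\boldsymbol{v}_d(g),N))\le\varepsilon\}.$$ Then these minima exist and $$\lim_{d+\varepsilon^{-1}\to\infty}\frac{\log N^{\mathrm{lat}}(\varepsilon,d)}{d+\log\varepsilon^{-1}}=0 \quad\text{and}\quad \lim_{d+\varepsilon^{-1}\to\infty}\frac{\log N^{\mathrm{kor}}(\varepsilon,d)}{d+\log\varepsilon^{-1}}=0,$$ where the limits are over all $(\varepsilon,d)\in(0,1)\times\mathbb{N}$ with $d+\varepsilon^{-1}\to\infty$. In particular $\lim_{d+\varepsilon^{-1}\to\infty}\frac{\log N(\varepsilon,d)}{d+\log\varepsilon^{-1}}=0$, i.e. EXP-weak tractability holds.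
   Context: $\mathbb{N}=\{1,2,\dots\}$. Let $\boldsymbol{a}=(a_j)_{j\ge1}$, $\boldsymbol{b}=(b_j)_{j\ge1}$ be sequences of positive reals with $0<a_1\le a_2\le\dots$ and $b_\ast=\inf_j b_j>0$. Fix $\omega\in(0,1)$. For $d\in\mathbb{N}$, $\mathcal{H}_{d,\boldsymbol{a},\boldsymbol{b}}$ is the reproducing kernel Hilbert space on $[0,1]^d$ with kernel $$K_{d,\boldsymbol{a},\boldsymbol{b}}(\boldsymbol{x},\boldsymbol{y})=\sum_{\boldsymbol{h}\in\mathbb{Z}^d}\omega^{\sum_{j=1}^d a_j|h_j|^{b_j}}\exp(2\pi \mathrm{i}\,\boldsymbol{h}\cdot(\boldsymbol{x}-\boldsymbol{y})).$$ Equivalently, it consists of the functions $f(\boldsymbol{x})=\sum_{\boldsymbol{h}\in\mathbb{Z}^d}\widehat f(\boldsymbol{h})\exp(2\pi\mathrm{i}\,\boldsymbol{h}\cdot\boldsymbol{x})$ with finite norm $\|f\|_{d,\boldsymbol{a},\boldsymbol{b}}=\big(\sum_{\boldsymbol{h}\in\mathbb{Z}^d}\omega^{-\sum_{j=1}^d a_j|h_j|^{b_j}}|\widehat f(\boldsymbol{h})|^2\big)^{1/2}$, where $\widehat f(\boldsymbol{h})=\int_{[0,1]^d} f(\boldsymbol{x})\exp(-2\pi\mathrm{i}\,\boldsymbol{h}\cdot\boldsymbol{x})\,d\boldsymbol{x}$. For a point set $\mathcal{P}=\{\boldsymbol{x}_0,\dots,\boldsymbol{x}_{N-1}\}\subset[0,1)^d$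 and coefficients $\boldsymbol{w}=(w_0,\dots,w_{N-1})\in\mathbb{C}^N$, the worst-case integration error is $$e(\mathcal{H}_{d,\boldsymbol{a},\boldsymbol{b}},\mathcal{P},\boldsymbol{w})=\sup_{\|f\|_{d,\boldsymbol{a},\boldsymbol{b}}\le1}\Big|\int_{[0,1]^d}f(\boldsymbol{x})\,d\boldsymbol{x}-\sum_{k=0}^{N-1}w_kf(\boldsymbol{x}_k)\Big|.$$ The $N$th minimal worst-case error is $e(N,d)=\inf_{\mathcal{P},\boldsymbol{w}}e(\mathcal{H}_{d,\boldsymbol{a},\boldsymbol{b}},\mathcal{P},\boldsymbol{w})$ (over all such $\mathcal{P}$, $\boldsymbol{w}$ with $N$ points); the initial error is $e(0,d)=1$. The information complexity is $N(\varepsilon,d)=\min\{N\in\mathbb{N}: e(N,d)\le\varepsilon\}$ for $\varepsilon\in(0,1)$. For $N\in\mathbb{N}$ put $G_N=\{0,1,\dots,N-1\}$. For $\boldsymbol{g}\in\mathbb{Z}^d$ the lattice rule with generating vector $\boldsymbol{g}$ is $Q_{N,d}(f)=\frac1N\sum_{k=0}^{N-1}f(\{\frac kN\boldsymbol{g}\})$, where $\{x\}=x-\lfloor x\rfloor$ is applied componentwise; its nodes (indexed by $k$, possibly with repetition) form $\mathcal{P}(\boldsymbol{g},N)$, and $e(\mathcal{H}_{d,\boldsymbol{a},\boldsymbol{b}},\mathcal{P}(\boldsymbol{g},N))$ denotes its worst-case error (all coefficients equal to $1/N$). A Korobov lattice rule is one with generating vector $\boldsymbol{v}_d(g)=(1,g,g^2,\dots,g^{d-1})$,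 $g\in G_N$. *)

(* Defs.v *)
From HB Require Import structures.
From mathcomp Require Import all_boot all_order all_algebra.
From mathcomp Require Import finmap complex.
From mathcomp Require Import all_classical all_reals all_analysis.

Set Implicit Arguments.
Unset Strict Implicit.
Unset Printing Implicit Defensive.

Import Order.TTheory GRing.Theory Num.Theory.
Import numFieldNormedType.Exports.

Local Open Scope classical_set_scope.
Local Open Scope ring_scope.
Local Open Scope complex_scope.

(** Indexing convention: a sequence $(a_j)_{j\ge1}$ is a function
    [a : nat -> R] with $a_{j+1}$ = [a j], and the coordinates $1,\dots,d$
    are numbered by [j : 'I_d]. *)

(** * Lebesgue measure and complex integrals on $[0,1]^d$ *)

Section LebesgueTuple.
Context (R : realType).
Let mR := measurableTypeR R.

Definition cons_pair n (p : n.-tuple mR * mR) : n.+1.-tuple mR :=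
  [tuple of p.2 :: p.1].

Lemma measurable_cons_pair n : measurable_fun setT (@cons_pair n).
Proof. exact: measurable_cons. Qed.

HB.instance Definition _ n :=
  isMeasurableFun.Build _ _ _ _ (@cons_pair n) (@measurable_cons_pair n).

Definition lebesgue_cons n (m : {measure set (n.-tuple mR) -> \bar R}) :=
  pushforward (m \x lebesgue_measure)%E (@cons_pair n).

Section lebesgue_cons_measure.
Variables (n : nat) (m : {measure set (n.-tuple mR) -> \bar R}).

Let lebesgue_cons0 : lebesgue_cons m set0 = 0%E.
Proof. exact: measure0. Qed.

Let lebesgue_cons_ge0 A : (0 <= lebesgue_cons m A)%E.
Proof. exact: measure_ge0. Qed.

Let lebesgue_cons_sigma_additive : semi_sigma_additive (lebesgue_cons m).
Proof. exact: measure_semi_sigma_additive. Qed.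

HB.instance Definition _ := isMeasure.Build _ _ _ (lebesgue_cons m)
  lebesgue_cons0 lebesgue_cons_ge0 lebesgue_cons_sigma_additive.

End lebesgue_cons_measure.

(** The $d$-fold product of the Lebesgue measure on the line. *)
Fixpoint lebesgue_tuple d : {measure set (d.-tuple mR) -> \bar R} :=
  match d with
  | 0 => \d_ ([tuple] : 0.-tuple mR)
  | n.+1 => lebesgue_cons (lebesgue_tuple n)
  end.

Definition cube d : set (d.-tuple mR) :=
  [set x | forall j, 0 <= tnth x j <= 1].

Definition cintegrable d (f : d.-tuple R -> R[i]) : Prop :=
  (lebesgue_tuple d).-integrable (@cube d) (EFin \o (@complex.Re R \o f)) /\
  (lebesgue_tuple d).-integrable (@cube d) (EFin \o (@complex.Im R \o f)).

Definition cintegral d (f : d.-tuple R -> R[i]) : R[i] :=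
  (\int[lebesgue_tuple d]_(x in @cube d) complex.Re (f x))
  +i* (\int[lebesgue_tuple d]_(x in @cube d) complex.Im (f x)).

Lemma measurable_cube d : measurable (@cube d).
Proof.
have -> : @cube d =
    \bigcap_(j in [set: 'I_d]) ((@tnth d mR ^~ j) @^-1` `[0%R, 1%R]).
  apply/seteqP; split => x /= h j.
    by move=> _; rewrite /= in_itv; exact: h.
  by have := h j I; rewrite /= in_itv.
apply: fin_bigcap_measurable => // j _.
rewrite -[X in measurable X]setTI.
by apply: measurable_tnth => //; exact: measurable_itv.
Qed.

Lemma lebesgue_tuple_cube d : lebesgue_tuple d (@cube d) = 1%E.
Proof.
elim: d => [|d ih] /=.
  rewrite /dirac/= indicE mem_set// => -[]//.
rewrite /lebesgue_cons /pushforward.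
have -> : @cons_pair d @^-1` @cube d.+1 = @cube d `*` `[0%R, 1%R]%classic.
  apply/seteqP; split => -[x y] /=.
    move=> h; split=> [j|]; last by have := h ord0; rewrite tnth0 in_itv.
    by have := h (lift ord0 j); rewrite tnthS.
  rewrite in_itv /= => -[hx hy] j.
  by case: (unliftP ord0 j) => [k ->|->]; rewrite ?tnthS ?tnth0//; exact: hx.
rewrite product_measure1E//=; last exact: measurable_cube.
by rewrite lebesgue_measure_itv/= lte_fin ltr01 oppr0 adde0 mule1.
Qed.

End LebesgueTuple.

(** * The spaces $\mathcal{H}_{d,a,b}$ *)

Section KorobovSpace.
Context (R : realType).
Implicit Types (a b : nat -> R) (omega : R).

Local Notation normc := (@Normc.normc R).

Definition expi (t : R) : R[i] := cos t +i* sin t.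

Definition dot d (h : d.-tuple int) (x : d.-tuple R) : R :=
  \sum_(j < d) (tnth h j)%:~R * tnth x j.

(** $\widehat f(h)$ *)
Definition fourier d (f : d.-tuple R -> R[i]) (h : d.-tuple int) : R[i] :=
  cintegral (fun x => f x * expi (- (2 * pi * dot h x))).

(** $\sum_{j=1}^d a_j|h_j|^{b_j}$ *)
Definition rho a b d (h : d.-tuple int) : R :=
  \sum_(j < d) a j * (`|tnth h j|%:~R `^ b j).

(** Unconditional convergence: [s] is the limit of the finite partial sums of
    [u] along the finite subsets of the index set. *)
Definition has_sum (I : choiceType) (u : I -> R[i]) (s : R[i]) : Prop :=
  forall e : R, 0 < e -> exists A : {fset I}, forall B : {fset I},
    (A `<=` B)%fset -> normc (\sum_(i <- B) u i - s) < e.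

(** Extended-valued, so that finiteness is a condition in [Hspace] below. *)
Definition Hnorm a b omega d (f : d.-tuple R -> R[i]) : \bar R :=
  ((\esum_(h in [set: d.-tuple int])
      (omega `^ (- rho a b h) * normc (fourier f h) ^+ 2)%:E) `^ 2^-1)%E.

(** Functions on $[0,1]^d$ are represented by functions on $\mathbb{R}^d$ of
    which only the values on the cube matter. *)
Definition Hspace a b omega d : set (d.-tuple R -> R[i]) :=
  [set f | [/\ cintegrable f,
               forall x, cube x ->
                 has_sum (fun h => fourier f h * expi (2 * pi * dot h x)) (f x)
             & (Hnorm a b omega f < +oo)%E]].

(** * Worst-case errors *)

(** An [N]-element point set is a family indexed by ['I_N], so that nodes are
    counted with multiplicity. *)

Definition wce a b omega d N (x : 'I_N -> d.-tuple R) (w : 'I_N -> R[i]) :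
    \bar R :=
  ereal_sup [set (normc (cintegral f - \sum_(k < N) w k * f (x k)))%:E |
    f in [set f | Hspace a b omega f /\ (Hnorm a b omega f <= 1)%E]].

(** $e(N,d)$ *)
Definition min_error a b omega N d : \bar R :=
  ereal_inf [set wce a b omega xw.1 xw.2 |
    xw in [set xw : ('I_N -> d.-tuple R) * ('I_N -> R[i]) |
             forall k j, 0 <= tnth (xw.1 k) j < 1]].

Definition frac (t : R) : R := t - (Num.floor t)%:~R.

Definition lattice_points N d (g : d.-tuple int) (k : 'I_N) : d.-tuple R :=
  [tuple frac (k%:R / N%:R * (tnth g j)%:~R) | j < d].

Definition lattice_error a b omega N d (g : d.-tuple int) : \bar R :=
  wce a b omega (@lattice_points N d g) (fun=> N%:R^-1).

Definition korobov_vector d (g : nat) : d.-tuple int :=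
  [tuple (g ^ j)%N%:Z | j < d].

(** * Complexities *)

Definition complexity_set a b omega (eps : R) d : set nat :=
  [set N | (0 < N)%N /\ (min_error a b omega N d <= eps%:E)%E].

Definition lat_set a b omega (eps : R) d : set nat :=
  [set N | (0 < N)%N /\ exists g : d.-tuple 'I_N,
     (lattice_error a b omega N [tuple (tnth g j : nat)%:Z | j < d]
       <= eps%:E)%E].

Definition kor_set a b omega (eps : R) d : set nat :=
  [set N | (0 < N)%N /\ exists g : 'I_N,
     (lattice_error a b omega N (korobov_vector d g) <= eps%:E)%E].

Definition is_min (A : set nat) (n : nat) : Prop :=
  A n /\ forall m, A m -> (n <= m)%N.

(** $d+\varepsilon^{-1}\to\infty$ over $(\varepsilon,d)\in(0,1)\times\mathbb{N}$ *)
Definition eps_d_infty : set_system (R * nat) :=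
  filter_from [set: R] (fun M =>
    [set p | [/\ 0 < p.1 < 1, (0 < p.2)%N & M < p.2%:R + p.1^-1]]).

Global Instance eps_d_infty_filter : ProperFilter eps_d_infty.
Proof.
apply: filter_from_proper; last first.
  move=> M _; exists (2^-1, (Num.bound `|M|).+1); split => //=.
    by rewrite invr_gt0 ltr0n/= invf_lt1 ?ltr1n// ltr0n.
  rewrite invrK -natrD; apply: (le_lt_trans (ler_norm M)).
  apply: (lt_le_trans (archi_boundP (normr_ge0 M))).
  by rewrite ler_nat addSn; exact/leqW/leq_addr.
apply: filter_fromT_filter; first by exists 0.
move=> M M'; exists (Num.max M M') => p /= [h1 h2].
by rewrite gt_max => /andP[h3 h4].
Qed.

Definition EXP_WT (N : R -> nat -> nat) : Prop :=
  (fun p : R * nat => ln (N p.1 p.2)%:R / (p.2%:R + ln p.1^-1))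
    @ eps_d_infty --> (0 : R).

End KorobovSpace.

(* Main.v *)
Require Import Defs.
From HB Require Import structures.
From mathcomp Require Import all_boot all_order all_algebra.
From mathcomp Require Import finmap complex.
From mathcomp Require Import all_classical all_reals all_analysis.
From mathcomp Require Import ring lra zify.

Set Implicit Arguments.
Unset Strict Implicit.
Unset Printing Implicit Defensive.

Import Order.TTheory GRing.Theory Num.Theory.
Import numFieldNormedType.Exports.

Local Open Scope classical_set_scope.
Local Open Scope ring_scope.

(** On a function of norm at most 1 a lattice rule makes an error bounded, via
    Cauchy-Schwarz on finite partial sums of the Fourier series, by the square
    root of the sum of omega^rho over the nonzero dual frequencies.  Write
    omega^rho = y^m with y = omega^(rho/m); since sum y^m <= (sum y)^m, it is
    enough to find N and g for which the dual sum of y is at most eps^(2/m).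
    For N prime a nonzero polynomial modulo N has at most d roots, so averaging
    over the N Korobov generators bounds that dual sum by d C(d) / N, where
    C(d) = e^(o(d)) because a_j tends to infinity.  Hence N may be chosen of
    order (d C(d) eps^(-2/m))^2, the square coming from the crude prime gap
    M < p <= 32 M^2, which follows from the growth of central binomials; then
    m tends to infinity. *)

(** * Primes between M and 32 M^2 *)

Section Primes.
Local Open Scope nat_scope.

(** Two uses of Pascal's rule exhibit two copies of ['C(n.*2, n)] inside the next central
    binomial. *)
Lemma exp2_leq_central_binomial n : 2 ^ n <= 'C(n.*2, n).
Proof.
elim: n => [//|n ih].
rewrite doubleS binS expnS mul2n -addnn leq_add //.
  by apply: (leq_trans ih); rewrite binS leq_addl.
apply: (leq_trans ih).
by case: n {ih} => [//|n]; rewrite [X in _ <= X]binS leq_addr.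
Qed.

(* Legendre's formula: each of the exponents [k] with [p ^ k <= 2n]
   contributes at most 1. *)
Lemma pfactor_central_binomial p n : prime p -> 0 < n ->
  p ^ logn p 'C(n.*2, n) <= n.*2.
Proof.
move=> pp n0.
have n20 : 0 < n.*2 by rewrite double_gt0.
suff h : logn p 'C(n.*2, n) <= trunc_log p n.*2.
  by apply: leq_trans (leq_pexp2l (prime_gt0 pp) h) (trunc_logP (prime_gt1 pp) n20).
have nn : n <= n.*2 by rewrite -addnn leq_addr.
have e : logn p (n.*2)`! = logn p 'C(n.*2, n) + (logn p n`!).*2.
  rewrite -(bin_fact nn) (_ : n.*2 - n = n); last by rewrite -addnn addnK.
  by rewrite !lognM ?fact_gt0 ?bin_gt0 ?muln_gt0 ?fact_gt0// addnn.
rewrite -(leq_add2r (logn p n`!).*2) -e !logn_fact //.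
rewrite (big_cat_nat (n := n.+1) _ _) //= ?ltnS //.
have big0 k : n < k -> n %/ p ^ k = 0.
  move=> nk; apply: divn_small; apply: (ltn_trans nk).
  exact: ltn_expl (prime_gt1 pp).
have -> : (\sum_(1 <= k < n.+1) n %/ p ^ k).*2 =
    \sum_(1 <= k < n.*2.+1) (n %/ p ^ k).*2.
  rewrite [RHS](big_cat_nat (n := n.+1) _ _) //= ?ltnS //.
  rewrite [X in _ = _ + X]big_nat_cond [X in _ = _ + X]big1 ?addn0; last first.
    by move=> k /andP[/andP[nk _] _]; rewrite big0.
  by rewrite -mul2n big_distrr /=; apply: eq_bigr => k _; rewrite mul2n.
rewrite -(big_cat_nat (n := n.+1) _ _ (F := fun k => n.*2 %/ p ^ k)) //= ?ltnS //.
have -> : trunc_log p n.*2 = \sum_(1 <= k < n.*2.+1) (k <= trunc_log p n.*2).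
  have tl : trunc_log p n.*2 <= n.*2.
    apply: leq_trans (trunc_logP (prime_gt1 pp) n20).
    by apply/ltnW/ltn_expl/prime_gt1.
  rewrite (big_cat_nat (n := (trunc_log p n.*2).+1) _ _) //= ?ltnS //.
  rewrite [X in _ = _ + X]big_nat_cond [X in _ = _ + X]big1 ?addn0; last first.
    by move=> k /andP[/andP[nk _] _]; rewrite leqNgt nk.
  rewrite big_nat_cond (eq_bigr (fun=> 1)); last first.
    by move=> k /andP[/andP[_ nk] _]; rewrite -ltnS nk.
  by rewrite -big_nat_cond sum_nat_const_nat muln1 subSS subn0.
rewrite -big_split /= big_nat_cond [X in _ <= X]big_nat_cond; apply: leq_sum => k /andP[/andP[k0 _] _].
case: (leqP k (trunc_log p n.*2)) => hk /=; last first.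
  rewrite divn_small //; apply: leq_trans (trunc_log_ltn _ (prime_gt1 pp)) _.
  by rewrite leq_pexp2l // prime_gt0.
have := divn_eq n (p ^ k); have : n %% p ^ k < p ^ k by rewrite ltn_mod expn_gt0 prime_gt0.
set q := n %/ _; set r := n %% _ => rp ne.
have pk0 : 0 < p ^ k by rewrite expn_gt0 prime_gt0.
rewrite -ltnS ltn_divLR // ne -!mul2n; nia.
Qed.

(** A prime factor of the binomial divides the factorial of [2n], so it is at most [2n] and hence at
    most [M]. This leaves at most [M] prime powers, each at most [2n]. *)
Lemma central_binomial_leq n M : 0 < n ->
  (forall p, prime p -> p <= n.*2 -> p <= M) -> 'C(n.*2, n) <= n.*2 ^ M.
Proof.
move=> n0 hM.
have nn : n <= n.*2 by rewrite -addnn leq_addr.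
have b0 : 0 < 'C(n.*2, n) by rewrite bin_gt0.
have n20 : 0 < n.*2 by rewrite double_gt0.
set b := 'C(n.*2, n) in b0 *.
rewrite -(partnT b0) (widen_partn _ (leq_maxr M b)).
rewrite (big_cat_nat (n := M.+1) _ _) //=; last by rewrite ltnS leq_maxl.
rewrite [X in _ * X]big_nat_cond [X in _ * X]big1 ?muln1; last first.
  move=> p /andP[/andP[Mp _] _].
  case: (posnP (logn p b)) => [->//|]; rewrite logn_gt0 mem_primes => /and3P[pp _ pb].
  suff : p <= M by rewrite leqNgt Mp.
  apply: hM => //.
  have : p %| (n.*2)`! by rewrite -(bin_fact nn) dvdn_mulr.
  elim: (n.*2) => [|i ih]; first by rewrite fact0 dvdn1 => /eqP p1; rewrite p1 in pp.
  rewrite factS Euclid_dvdM // => /orP[/dvdn_leq -> //|/ih].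
  exact: leqW.
rewrite big_ltn // lognE /= mul1n.
rewrite (_ : n.*2 ^ M = \prod_(1 <= i < M.+1) n.*2); last first.
  by rewrite prod_nat_const_nat subSS subn0.
apply: leq_prod => p _; case: (boolP (prime p)) => pp.
  exact: pfactor_central_binomial.
by rewrite lognE (negbTE pp).
Qed.

(** Were there no prime in [(M, 2^(s+1)]], the two bounds on the central binomial with [n = 2^s]
    would give [2^s <= (s+1) M]. *)
Lemma exists_prime_between M : 0 < M ->
  exists2 p, prime p & M < p <= 32 * M ^ 2.
Proof.
move=> M0; pose k := (trunc_log 2 M).+1.
have Mk : M < 2 ^ k by exact: trunc_log_ltn.
have kM : 2 ^ k <= 2 * M by rewrite expnS leq_mul2l /= trunc_logP.
(* With [M < 2^k <= 2M], this [s] gives both [2^(s+1) = 8 * 4^k <= 32 M^2] and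
   [(s+1) M < 2^(k+2) 2^k = 2^s]. *)
pose s := k.*2.+2.
have e2 : (2 ^ s).*2 = 8 * (2 ^ k) ^ 2.
  by rewrite -mul2n -expnS -expnM muln2 (_ : 8 = 2 ^ 3) // -expnD.
have [h|/existsPn h] := boolP [exists p : 'I_(2 ^ s).*2.+1, prime p && (M < p)].
  have [p /andP[pp Mp]] := existsP h.
  exists p => //; rewrite Mp /=.
  have : p <= 8 * (2 ^ k) ^ 2 by rewrite -e2 -ltnS.
  move=> /leq_trans; apply; nia.
have := @central_binomial_leq (2 ^ s) M (expn_gt0 _ _).
have hp p : prime p -> p <= (2 ^ s).*2 -> p <= M.
  rewrite -ltnS => pp ps; have := h (Ordinal ps).
  by rewrite pp /= -leqNgt.
move=> /(_ hp) /(leq_trans (exp2_leq_central_binomial _)).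
rewrite -mul2n -expnS -expnM leq_exp2l // => hs; exfalso.
suff : s.+1 * M < 2 ^ s by rewrite ltnNge hs.
have hk : s.+1 <= 2 ^ k.+2.
  rewrite /s; elim: (k) => // i; rewrite [2 ^ i.+3]expnS; lia.
have -> : 2 ^ s = 2 ^ k.+2 * 2 ^ k by rewrite -expnD /s -addnn addSn addSn.
apply: (@leq_ltn_trans (2 ^ k.+2 * M)); first by rewrite leq_mul2r hk orbT.
by rewrite ltn_mul2l expn_gt0 Mk.
Qed.

End Primes.

(** * Averages, sums over the lattice and root counting *)

Lemma ler_sum_fset_sub (R : numDomainType) (I : choiceType) (P : pred I)
    (F : I -> R) (A B : {fset I}) :
  (forall i, 0 <= F i) -> (A `<=` B)%fset ->
  \sum_(i <- A | P i) F i <= \sum_(i <- B | P i) F i.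
Proof.
move=> F0 AB; rewrite big_mkcond [leRHS]big_mkcond /=.
rewrite (eq_big_seq (fun i => if i \in A then if P i then F i else 0 else 0));
  last by move=> i ->.
rewrite (big_fset_incl _ AB) /=; last by move=> i _ /negbTE ->.
by apply: ler_sum => i _; case: ifP => _ //; case: ifP.
Qed.

(** If every [g] failed, each would have a finite witness set. On the union of these sets the double
    sum over [g] and [h] exceeds [C * W], whereas exchanging the sums and counting bounds it by
    [C * W]. One [g] thus serves all finite [B]. *)
Lemma exists_le_average (R : realFieldType) (G : finType) (I : choiceType)
    (D : G -> pred I) (y z : I -> R) (C W : R) :
  (0 < #|G|)%N -> (forall h, 0 <= y h) -> 0 <= C ->
  (forall h, #|[pred g | D g h]|%:R * y h <= C * z h) ->
  (forall B : {fset I}, \sum_(h <- B) z h <= W) ->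
  exists g, forall B : {fset I}, \sum_(h <- B | D g h) y h <= C * W / #|G|%:R.
Proof.
move=> G0 y0 C0 hy hz; apply/not_existsP => hg.
have /choice[Bf hB] g : exists B : {fset I},
    C * W / #|G|%:R < \sum_(h <- B | D g h) y h.
  have /existsNP[B] := hg g.
  by move=> /negP; rewrite -ltNge => hB; exists B.
pose B : {fset I} := \big[@fsetU I/fset0]_(g : G) Bf g.
have lt_sum : \sum_(g : G) C * W / #|G|%:R
              < \sum_(g : G) \sum_(h <- B | D g h) y h.
  have /card_gt0P[g0 _] := G0.
  have hB' g : C * W / #|G|%:R < \sum_(h <- B | D g h) y h.
    apply: (lt_le_trans (hB g)); apply: ler_sum_fset_sub => //.
    exact: bigfcup_sup.
  rewrite (bigD1 g0) //= [ltRHS](bigD1 g0) //=; apply: ltr_leD => //.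
  by apply: ler_sum => g _; exact: ltW.
move: lt_sum; rewrite sumr_const -[C * W / _ *+ _]mulr_natr divfK ?pnatr_eq0 -?lt0n //.
apply/negP; rewrite -leNgt.
apply: (@le_trans _ _ (\sum_(h <- B) C * z h)); last first.
  by rewrite -mulr_sumr ler_wpM2l.
under eq_bigr do rewrite big_mkcond.
rewrite exchange_big /=; apply: ler_sum => h _.
apply: le_trans (hy h).
by rewrite mulr_natl -(sumr_const [pred g | D g h]) -big_mkcond.
Qed.

(** The finite set [B] lies in a box, over which the sum of products factorises; nonnegativity
    allows the enlargement to the box. *)
Lemma sum_prod_tuple_int_le (R : realDomainType) d (phi : 'I_d -> int -> R)
    (Z : 'I_d -> R) (B : {fset d.-tuple int}) :
  (forall j t, 0 <= phi j t) ->
  (forall j H, \sum_(i < H) phi j (Posz i) + \sum_(i < H) phi j (Negz i) <= Z j) ->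
  \sum_(h <- B) \prod_(j < d) phi j (tnth h j) <= \prod_(j < d) Z j.
Proof.
move=> phi0 hZ.
pose H := (\max_(h <- B) \max_(j < d) `|tnth h j|)%N.
have hH h j : h \in B -> (`|tnth h j| < H.+1)%N.
  move=> hB; rewrite ltnS.
  apply: (@leq_trans (\max_(j < d) `|tnth h j|)).
    exact: (leq_bigmax_cond (F := fun j => `|tnth h j|%N)).
  exact: (leq_bigmax_seq (F := fun h : d.-tuple int => (\max_(j < d) `|tnth h j|)%N)).
(* A sign and an index up to [H] encode an integer as [Posz] or [Negz], matching the two sums in the
   hypothesis on [Z]. *)
pose J : finType := (bool * 'I_H.+1)%type.
pose dec (u : J) := if u.1 then Posz u.2 else Negz u.2.
pose enc (t : int) : J :=
  match t with Posz n => (true, inord n) | Negz n => (false, inord n) end.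
have encK t : (`|t| < H.+1)%N -> dec (enc t) = t.
  case: t => n hn; rewrite /dec /enc /= inordK //.
  exact: ltnW hn.
pose E (h : d.-tuple int) : {ffun 'I_d -> J} := [ffun j => enc (tnth h j)].
have Einj : {in B &, injective E}.
  move=> h h' hB hB' /ffunP e; apply: eq_from_tnth => j.
  by have := e j; rewrite !ffunE => /(congr1 dec); rewrite !encK ?hH.
apply: (@le_trans _ _ (\prod_(j < d) \sum_(u : J) phi j (dec u))); last first.
  apply: ler_prod => j _; rewrite sumr_ge0 //=.
  rewrite -(pair_bigA _ (fun b i => phi j (dec (b, i)))) /=.
  by rewrite big_bool /=; exact: hZ.
rewrite bigA_distr_bigA /=.
have -> : \sum_(h <- B) \prod_(j < d) phi j (tnth h j) =
    \sum_(f <- map E B) \prod_(j < d) phi j (dec (f j)).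
  rewrite big_map; apply: eq_big_seq => h hB; apply: eq_bigr => j _.
  by rewrite ffunE encK // hH.
rewrite big_uniq /=; last by rewrite map_inj_in_uniq ?fset_uniq.
rewrite big_mkcond /=; apply: ler_sum => f _.
by case: ifP => // _; apply: prodr_ge0.
Qed.

(** Kept in [int], unlike [dot], so that membership of [h] in the dual lattice is divisibility by
    [N]. *)
Definition idot d (h g : d.-tuple int) : int :=
  \sum_(j < d) tnth h j * tnth g j.

(** A generator dual to [h] is, modulo [p], a root of the polynomial with coefficients [h_j], which
    is nonzero over ['F_p] and of degree below [d]. Distinct generators stay distinct modulo [p]. *)
Lemma card_korobov_dual_le p d (h : d.-tuple int) : prime p ->
  (exists j, ~~ (p %| tnth h j)%Z) ->
  (#|[pred g : 'I_p | (p %| (\sum_(j < d) tnth h j * (g ^ j)%N%:Z)%R)%Z]| <= d)%N.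
Proof.
move=> pp [j0 hj0].
pose P : {poly 'F_p} := \sum_(j < d) (tnth h j)%:~R *: 'X^j.
have cP (j : 'I_d) : P`_j = (tnth h j)%:~R.
  rewrite coef_sum (bigD1 j) //= coefZ coefXn eqxx mulr1 big1 ?addr0 // => i ij.
  by rewrite coefZ coefXn (_ : (j : nat) == i = false) ?mulr0 //;
    apply/negbTE; rewrite eq_sym.
have P0 : P != 0.
  apply/eqP => P0; move: hj0; rewrite (dvdz_pcharf (pchar_Fp pp)).
  by rewrite -cP P0 coef0 eqxx.
have sP : (size P <= d)%N.
  apply: (leq_trans (size_sum _ _ _)); apply/bigmax_leqP => j _.
  by rewrite (leq_trans (size_scale_leq _ _)) // size_polyXn.
set S := [pred g | _].
pose rs : seq 'F_p := [seq (g : nat)%:R | g : 'I_p <- enum S].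
rewrite cardE -(size_map (fun g : 'I_p => (g : nat)%:R : 'F_p)).
apply: leq_trans sP; apply: ltnW; apply: (@max_poly_roots _ P rs) => //.
  apply/allP => x /mapP[g]; rewrite mem_enum inE => hg ->.
  rewrite rootE /P horner_sum; move: hg.
  rewrite (dvdz_pcharf (pchar_Fp pp)) rmorph_sum /= => /eqP {2}<-; apply/eqP.
  apply: eq_bigr => j _; rewrite hornerZ hornerXn rmorphM /= -natrX.
  by [].
rewrite map_inj_uniq ?enum_uniq // => g g' e; apply: val_inj.
have := congr1 val e; rewrite /= !val_Fp_nat // !modn_small //.
Qed.

(** * The worst-case error of a lattice rule *)

Section LatticeError.
Context (R : realType).
Local Notation normc := (@Normc.normc R).

Lemma expi0 : expi (0 : R) = 1.
Proof. by rewrite /expi cos0 sin0. Qed.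

Lemma expiD (x y : R) : expi (x + y) = expi x * expi y.
Proof.
rewrite /expi cosD sinD; apply/eqP; rewrite eq_complex /= eqxx /=.
by rewrite addrC [sin x * _]mulrC [cos x * _]mulrC addrC; apply/eqP; ring.
Qed.

Lemma expi_natmul (x : R) n : expi (n%:R * x) = expi x ^+ n.
Proof.
elim: n => [|n ih]; first by rewrite mul0r expi0.
by rewrite -natr1 mulrDl mul1r expiD ih exprSr.
Qed.

Lemma expi_2pi_int (z : int) : expi (2 * pi * z%:~R : R) = 1.
Proof.
have h n : expi (2 * pi * n%:R : R) = 1.
  rewrite [_ * n%:R]mulrC expi_natmul /expi mulr_natl.
  by rewrite cos2pi sin2pi expr1n.
case: z => n; first exact: h.
have : expi (2 * pi * (Negz n)%:~R : R) * expi (2 * pi * n.+1%:R) = 1.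
  by rewrite -expiD -mulrDr NegzE mulrNz addNr mulr0 expi0.
by rewrite h mulr1.
Qed.

Lemma normc_expi (x : R) : normc (expi x) = 1.
Proof. by rewrite /= cos2Dsin2 sqrtr1. Qed.

Lemma normc_sum (I : Type) (r : seq I) (P : pred I) (F : I -> R[i]) :
  normc (\sum_(i <- r | P i) F i) <= \sum_(i <- r | P i) normc (F i).
Proof.
elim/big_ind2: _ => //; first by rewrite Normc.normc0.
move=> x1 x2 y1 y2 h1 h2; apply: (le_trans (le_normcD _ _)); exact: lerD.
Qed.

Lemma normc_natr n : normc n%:R = n%:R.
Proof.
elim: n => [|n ih]; first by rewrite Normc.normc0.
have -> : (n.+1%:R : R[i]) = (n.+1%:R : R)%:C%C by rewrite rmorph_nat.
by rewrite /= expr0n /= addr0 sqrtr_sqr ger0_norm.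
Qed.

(** Only the residue [r] of [s] matters. If it is nonzero, the half angle [pi r / N] lies in
    [(0, pi)], where the sine is positive, so the cosine of the double angle cannot be 1. *)
Lemma expi_2pi_frac_eq1 (N : nat) (s : int) : (0 < N)%N ->
  expi (2 * pi * (s%:~R / N%:R) : R) = 1 -> (N %| s)%Z.
Proof.
move=> N0 hs; apply/dvdz_mod0P.
have N0R : (0 : R) < N%:R by rewrite ltr0n.
pose r := (s %% N)%Z.
have r0 : 0 <= r by rewrite modz_ge0 // eqz_nat -lt0n.
have rN : r < N by rewrite /r ltz_pmod.
have hr : expi (2 * pi * (r%:~R / N%:R) : R) = 1.
  have es : s%:~R = (s %/ N)%Z%:~R * N%:R + r%:~R :> R.
    by rewrite -[N%:R]/((N%:Z)%:~R) -intrM -intrD -divz_eq.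
  rewrite -hs es [(_ * _ + _) / _]mulrDl mulfK ?gt_eqF //.
  by rewrite [2 * pi * (_ + _)]mulrDr expiD expi_2pi_int mul1r.
apply/eqP/negPn/negP => rn0.
pose t : R := pi * (r%:~R / N%:R).
have t0 : 0 < t < pi.
  have rr : (0 : R) < r%:~R by rewrite ltr0z lt_neqAle eq_sym rn0.
  rewrite /t mulr_gt0 ?pi_gt0 ?divr_gt0 //= gtr_pMr ?pi_gt0 //.
  by rewrite ltr_pdivrMr // mul1r -[N%:R]/((N%:Z)%:~R) ltr_int.
have := sin_gt0_pi t0; have := cos2Dsin2 t.
have : cos (t *+ 2) = 1.
  rewrite -mulr_natl /t mulrA; by move: hr => [].
rewrite cos_mulr2n; nra.
Qed.

(** Fractional parts change the dot product by an integer, which the character does not see; what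
    remains is linear in [k]. *)
Lemma dot_lattice_points N d (h g : d.-tuple int) (k : 'I_N) :
  expi (2 * pi * dot h (@lattice_points R N d g k)) =
  expi (2 * pi * ((idot h g)%:~R / N%:R)) ^+ k.
Proof.
rewrite -expi_natmul /dot.
have -> : \sum_(j < d) (tnth h j)%:~R * tnth (@lattice_points R N d g k) j =
  k%:R * ((idot h g)%:~R / N%:R) -
  (\sum_(j < d) tnth h j * Num.floor (k%:R / N%:R * (tnth g j)%:~R : R))%:~R.
  rewrite /idot !rmorph_sum /= mulr_suml mulr_sumr -sumrB.
  apply: eq_bigr => j _; rewrite tnth_mktuple /Defs.frac mulrBr !rmorphM /=.
  by congr (_ - _); ring.
rewrite mulrBr expiD -mulrN -rmorphN /= expi_2pi_int mulr1.
by congr expi; ring.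
Qed.

Lemma lattice_character_mean N d (h g : d.-tuple int) : (0 < N)%N ->
  \sum_(k < N) N%:R^-1 * expi (2 * pi * dot h (@lattice_points R N d g k)) =
  (N %| idot h g)%Z%:R.
Proof.
move=> N0; have N0C : (N%:R : R[i]) != 0 by rewrite pnatr_eq0 -lt0n.
under eq_bigr do rewrite dot_lattice_points.
set r := expi _; rewrite -mulr_sumr.
case: (boolP (N %| idot h g)%Z) => hN.
  have -> : r = 1.
    rewrite /r; case/dvdzP: hN => q ->; rewrite rmorphM /= mulfK ?expi_2pi_int //.
    by rewrite pnatr_eq0 -lt0n.
  under eq_bigr do rewrite expr1n.
  by rewrite sumr_const card_ord mulVf.
(* Off the dual lattice [r] is an [N]th root of unity other than 1, so its geometric sum
   vanishes. *)
have rN1 : r - 1 != 0.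
  rewrite subr_eq0; apply: contra hN => /eqP; exact: expi_2pi_frac_eq1.
have rN : r ^+ N = 1.
  rewrite -expi_natmul mulrCA [N%:R * _]mulrC divfK ?expi_2pi_int //.
  by rewrite pnatr_eq0 -lt0n.
have := subrX1 r N; rewrite rN subrr => /esym/eqP.
by rewrite mulf_eq0 (negbTE rN1) /= => /eqP ->; rewrite mulr0.
Qed.

Definition zerot d : d.-tuple int := [tuple 0 | j < d].

Lemma fourier0 d (f : d.-tuple R -> R[i]) : fourier f (zerot d) = cintegral f.
Proof.
rewrite /fourier; congr cintegral; apply/funext => x.
rewrite /dot big1 ?mulr0 ?oppr0 ?expi0 ?mulr1 // => j _.
by rewrite tnth_mktuple mul0r.
Qed.

Lemma Hnorm_le1_fset (a b : nat -> R) omega d (f : d.-tuple R -> R[i])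
    (B : {fset d.-tuple int}) : (Hnorm a b omega f <= 1)%E ->
  \sum_(h <- B) omega `^ (- rho a b h) * normc (fourier f h) ^+ 2 <= 1.
Proof.
rewrite /Hnorm; set S := (\esum_(h in _) _)%E => hS.
have S0 : (0 <= S)%E.
  by apply: esum_ge0 => h _; rewrite lee_fin mulr_ge0 ?powR_ge0 ?sqr_ge0.
have S1 : (S <= 1)%E.
  have -> : S = ((S `^ 2^-1) `^ 2)%E by rewrite -poweRrM mulVf ?poweRe1.
  rewrite -(poweR1r 2).
  by apply: gt0_ler_poweR => //; rewrite in_itv /= ?poweR_ge0 ?leey ?lee01.
rewrite -lee_fin; apply: le_trans S1.
apply: ereal_sup_ubound; exists [set` B]; first by split.
by rewrite -fsbig_seq ?fset_uniq // sumEFin.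
Qed.

(** The rule applied to a finite Fourier sum keeps exactly the coefficients on the dual lattice. The
    zero frequency yields the integral and the others the error [Q], while truncation costs an
    arbitrary [eta]. *)
Lemma lattice_error_le (a b : nat -> R) omega N d (g : d.-tuple int) (e : R) :
  0 < omega -> (0 < N)%N -> 0 < e ->
  (forall B : {fset d.-tuple int},
     \sum_(h <- B | (h != zerot d) && (N %| idot h g)%Z) omega `^ rho a b h
       <= e ^+ 2) ->
  (lattice_error a b omega N g <= e%:E)%E.
Proof.
move=> omega0 N0 e0 hB; apply: ge_ereal_sup => _ [f [[_ hf _] f1] <-].
rewrite lee_fin; apply/ler_addgt0Pr => eta eta0.
set x := @lattice_points R N d g.
have N0R : (0 : R) < N%:R by rewrite ltr0n.
have xcube k : cube (x k).
  move=> j; rewrite tnth_mktuple /Defs.frac subr_ge0 floor_le /= lerBlDl.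
  by apply/ltW; have := floorD1_gt (k%:R / N%:R * (tnth g j)%:~R : R); rewrite rmorphD.
pose u k h := fourier f h * expi (2 * pi * dot h (x k)).
have /choice[Ak hA] k := hf _ (xcube k) eta eta0.
(* One finite set of frequencies that approximates [f] at all [N] nodes at once; it contains zero so
   that the integral appears in the sum. *)
pose A : {fset d.-tuple int} :=
  (zerot d |` \big[@fsetU _/fset0]_(k : 'I_N) Ak k)%fset.
have {}hA k : normc (\sum_(h <- A) u k h - f (x k)) < eta.
  apply: hA; apply: (fsubset_trans _ (fsubsetU1 _ _)); exact: bigfcup_sup.
pose Q := \sum_(h <- A | (h != zerot d) && (N %| idot h g)%Z) fourier f h.
have mean : \sum_(k < N) N%:R^-1 * \sum_(h <- A) u k h = cintegral f + Q.
  under eq_bigr do rewrite mulr_sumr.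
  rewrite exchange_big /=.
  have -> : \sum_(h <- A) \sum_(k < N) N%:R^-1 * u k h =
      \sum_(h <- A | (N %| idot h g)%Z) fourier f h.
    rewrite [RHS]big_mkcond; apply: eq_bigr => h _.
    rewrite -mulrb -[fourier f h *+ _]mulr_natr -(lattice_character_mean _ _ N0) mulr_sumr.
    by apply: eq_bigr => k _; rewrite /u mulrCA.
  rewrite big_mkcond (bigD1_seq (zerot d)) ?fset_uniq //=; last by rewrite !inE eqxx.
  rewrite -big_mkcondr /= (_ : (N %| idot (zerot d) g)%Z) ?fourier0 //.
  by rewrite /idot big1 ?dvdz0 // => j _; rewrite tnth_mktuple mul0r.
have -> : cintegral f - \sum_(k < N) N%:R^-1 * f (x k) =
   - Q + \sum_(k < N) N%:R^-1 * (\sum_(h <- A) u k h - f (x k)).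
  under [X in _ = _ + X]eq_bigr do rewrite mulrBr.
  by rewrite sumrB mean; ring.
apply: (le_trans (le_normcD _ _)); rewrite normcN; apply: lerD; last first.
  apply: (le_trans (normc_sum _ _ _)).
  apply: (@le_trans _ _ (\sum_(k < N) N%:R^-1 * eta)).
    apply: ler_sum => k _; rewrite Normc.normcM Normc.normcV normc_natr.
    by rewrite ler_wpM2l ?invr_ge0 //; exact: ltW.
  by rewrite sumr_const card_ord -[_ * eta *+ _]mulr_natl mulrA divff ?gt_eqF // mul1r.
apply: (le_trans (normc_sum _ _ _)).
(* AM-GM: [2 |c| <= e omega^(-rho) |c|^2 + omega^rho / e] *)
pose P h := (h != zerot d) && (N %| idot h g)%Z.
apply: (@le_trans _ _ (\sum_(h <- A | P h)
   (e / 2 * (omega `^ (- rho a b h) * normc (fourier f h) ^+ 2) +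
    (2 * e)^-1 * omega `^ rho a b h))).
  apply: ler_sum => h _.
  rewrite powRN; set w := omega `^ _; set c := normc _.
  have w0 : 0 < w by rewrite powR_gt0.
  rewrite -subr_ge0 (_ : _ - c = (e * c - w) ^+ 2 / (2 * e * w)).
    by rewrite divr_ge0 ?sqr_ge0 // !mulr_ge0 ?ltW.
  by field; rewrite !gt_eqF.
rewrite big_split /= -!mulr_sumr.
have h1 : \sum_(h <- A | P h) omega `^ (- rho a b h) * normc (fourier f h) ^+ 2 <= 1.
  apply: le_trans (Hnorm_le1_fset A f1).
  rewrite [leRHS](bigID P) /= lerDl; apply: sumr_ge0 => h _.
  by rewrite mulr_ge0 ?powR_ge0 ?sqr_ge0.
have h2 := hB A.
apply: (@le_trans _ _ (e / 2 * 1 + (2 * e)^-1 * e ^+ 2)).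
  by apply: lerD; rewrite ler_pM2l ?divr_gt0 ?invr_gt0 ?mulr_gt0.
rewrite le_eqVlt; apply/orP; left; apply/eqP; field; by rewrite gt_eqF.
Qed.

End LatticeError.

(** * Good Korobov generators *)

(** For an integer [k > 2 / beta], [exp x = exp (x/k)^k >= (x/k)^k]; at [x = gam n^beta] the power
    of [n] is at least [n^2]. *)
Lemma expR_Npowr_le_invsq (R : realType) (gam beta : R) : 0 < gam -> 0 < beta ->
  exists2 c : R, 0 < c &
    forall n : nat, (0 < n)%N -> expR (- (gam * n%:R `^ beta)) <= c / n%:R ^+ 2.
Proof.
move=> g0 b0; pose k := (Num.trunc (2 / beta)).+1.
have k0 : (0 : R) < k%:R by rewrite ltr0n.
have hk : 2 <= beta * k%:R.
  by rewrite mulrC -ler_pdivrMr //; exact/ltW/truncnS_gt.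
exists ((gam / k%:R)^-1 ^+ k); first by rewrite exprn_gt0 ?invr_gt0 ?divr_gt0.
move=> n n0; have n1 : (1 : R) <= n%:R by rewrite ler1n.
have nR0 : (0 : R) < n%:R by rewrite ltr0n.
rewrite exprVn -invfM expRN lef_pV2 ?posrE ?expR_gt0 //; last first.
  by rewrite mulr_gt0 ?exprn_gt0 ?divr_gt0.
have -> : gam * n%:R `^ beta = k%:R * (gam / k%:R * n%:R `^ beta).
  by field; rewrite gt_eqF.
rewrite expRM_natl.
apply: (@le_trans _ _ ((gam / k%:R * n%:R `^ beta) ^+ k)).
  rewrite [leRHS]exprMn ler_pM2l ?exprn_gt0 ?divr_gt0 //.
  rewrite -(powR_mulrn k) ?powR_ge0 // -powRrM -powR_mulrn ?(ltW nR0) //.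
  exact: ler_powR.
have q0 : 0 <= gam / k%:R * n%:R `^ beta.
  by rewrite mulr_ge0 ?powR_ge0 // divr_ge0 // ltW.
apply: lerXn2r; rewrite ?nnegrE ?expR_ge0 //.
by apply: le_trans (expR_ge1Dx _); rewrite lerDr.
Qed.

Lemma sum_invsq_le2 (R : realType) H : \sum_(i < H) (i.+1%:R ^+ 2)^-1 <= 2 :> R.
Proof.
case: H => [|H]; first by rewrite big_ord0.
(* The induction runs on this sharper telescoping bound. *)
apply: (@le_trans _ _ (2 - H.+1%:R^-1)); last by rewrite gerBl invr_ge0.
elim: H => [|H ih]; first by rewrite big_ord_recl big_ord0 /= expr1n invr1; lra.
rewrite big_ord_recr /=; apply: (le_trans (lerD ih (lexx _))).
rewrite -subr_ge0.
have -> : 2 - H.+2%:R^-1 - (2 - H.+1%:R^-1 + (H.+2%:R ^+ 2)^-1) =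
  (H.+1%:R * H.+2%:R ^+ 2)^-1 :> R.
  rewrite -[H.+2]addn1 natrD; field.
  by rewrite !gt_eqF // ?ltr_wpDl ?ltr0n.
by rewrite invr_ge0 mulr_ge0 ?exprn_ge0.
Qed.

Section Weights.
Context (R : realType) (a b : nat -> R).
Hypothesis a_gt0 : forall j, 0 < a j.
Hypothesis a_nondecreasing : forall i j, (i <= j)%N -> a i <= a j.
Hypothesis b_gt0 : forall j, 0 < b j.
Hypothesis b_inf_gt0 : 0 < inf (range b).
Hypothesis a_infty : a @ \oo --> +oo.

Lemma inf_range_le j : inf (range b) <= b j.
Proof.
apply: ge_inf; last by exists j.
by exists 0 => _ [i _ <-]; exact: ltW.
Qed.

(** For [gam = - t * ln omega] this is [omega^(t rho)], so that roots and powers of [omega^rho]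
    amount to scaling [gam]. *)
Definition weight (gam : R) d (h : d.-tuple int) : R :=
  expR (- (gam * rho a b h)).

Lemma weight_ge0 gam d (h : d.-tuple int) : 0 <= weight gam h.
Proof. exact: expR_ge0. Qed.

Lemma rho_ge0 d (h : d.-tuple int) : 0 <= rho a b h.
Proof. by apply: sumr_ge0 => j _; rewrite mulr_ge0 ?powR_ge0 // ltW. Qed.

(** The 1 accounts for the zero frequency. For [p >= 1], [a_j p >= (a_j - a_0) + a_0 p], which
    extracts the factor decaying in [j] and leaves a sum bounded uniformly in [j] through inverse
    squares. *)
Lemma coord_weight_sum_le (gam : R) : 0 < gam -> exists2 Z : R, 0 < Z &
  forall j H,
    \sum_(i < H) expR (- (gam * (a j * `|Posz i|%:~R `^ b j))) +
    \sum_(i < H) expR (- (gam * (a j * `|Negz i|%:~R `^ b j)))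
    <= 1 + Z * expR (- (gam * (a j - a 0%N))).
Proof.
move=> g0.
have [c c0 hc] := @expR_Npowr_le_invsq _ (gam * a 0%N) (inf (range b))
  (mulr_gt0 g0 (a_gt0 _)) b_inf_gt0.
(* Each sign contributes [c] times a sum of inverse squares, at most [2 * c]. *)
exists (4 * c); first by rewrite mulr_gt0.
move=> j H; set E := expR (- (gam * (a j - a 0%N))).
have E0 : 0 < E by exact: expR_gt0.
have a0j : a 0%N <= a j by exact: a_nondecreasing.
have hn n : expR (- (gam * (a j * n.+1%:R `^ b j))) <= E * c * (n.+1%:R ^+ 2)^-1.
  rewrite -mulrA; apply: (@le_trans _ _
     (E * expR (- (gam * a 0%N * n.+1%:R `^ inf (range b))))); last first.
    by rewrite ler_pM2l // hc.
  rewrite /E -expRD ler_expR -opprD lerN2 -mulrA -mulrDr ler_pM2l //.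
  have n1 : (1 : R) <= n.+1%:R by rewrite ler1n.
  have h1 : 1 <= n.+1%:R `^ inf (range b).
    by rewrite -[leLHS](powRr0 n.+1%:R); apply: ler_powR => //; exact: ltW.
  have h2 : n.+1%:R `^ inf (range b) <= n.+1%:R `^ b j.
    by apply: ler_powR => //; exact: inf_range_le.
  apply: (@le_trans _ _ (a j * n.+1%:R `^ inf (range b))); last by rewrite ler_pM2l.
  by move: h1; set p := _ `^ _; nra.
have hs H' : \sum_(i < H') expR (- (gam * (a j * i.+1%:R `^ b j))) <= 2 * c * E.
  apply: (@le_trans _ _ (\sum_(i < H') E * c * (i.+1%:R ^+ 2)^-1)).
    by apply: ler_sum => i _; exact: hn.
  rewrite -mulr_sumr [2 * c * E](_ : _ = E * c * 2); last by ring.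
  by rewrite ler_pM2l ?mulr_gt0 // sum_invsq_le2.
have -> : 4 * c * E = 2 * c * E + 2 * c * E by ring.
rewrite addrA; apply: lerD; last exact: (hs H).
case: H => [|H]; first by rewrite big_ord0 addr_ge0 ?mulr_ge0 ?ltW.
rewrite big_ord_recl /=; apply: lerD; last exact: hs.
by rewrite powR0 ?gt_eqF // !mulr0 oppr0 expR0.
Qed.

Lemma weight_prod (gam : R) d (h : d.-tuple int) :
  weight gam h = \prod_(j < d) expR (- (gam * (a j * `|tnth h j|%:~R `^ b j))).
Proof. by rewrite /weight /rho mulr_sumr -sumrN expR_sum. Qed.

(** The product of the factors [1 + z_j] is at most the exponential of the sum of the [z_j]. Since
    [a] tends to infinity, all but the first [J] of the [z_j] are at most [del]. *)
Lemma sum_weight_le (gam del : R) : 0 < gam -> 0 < del -> exists K : R,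
  forall d (B : {fset d.-tuple int}),
    \sum_(h <- B) weight gam h <= expR (K + del * d%:R).
Proof.
move=> g0 d0; have [Z Z0 hZ] := coord_weight_sum_le g0.
have [J hJ] : exists J, forall j, (J <= j)%N ->
    Z * expR (- (gam * (a j - a 0%N))) <= del.
  have /cvgryPge /(_ (a 0%N + ln (Z / del) / gam)) [J _ hJ] := a_infty.
  exists J => j Jj; have := hJ j Jj => /= haj.
  apply: (@le_trans _ _ (Z * expR (- ln (Z / del)))).
    by rewrite ler_pM2l // ler_expR lerN2 [leRHS]mulrC -ler_pdivrMr // lerBrDl.
  by rewrite expRN lnK ?posrE ?divr_gt0 // invf_div mulrC divfK ?gt_eqF.
(* The first [J] coordinates cost at most [Z] each beyond the slope [del]. *)
exists (Z * J%:R) => d B.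
under eq_bigr do rewrite weight_prod.
apply: le_trans (@sum_prod_tuple_int_le _ d
  (fun j t => expR (- (gam * (a j * `|t|%:~R `^ b j)))) _ B _ (fun j H => hZ j H)) _.
  by move=> j t; exact: expR_ge0.
apply: (@le_trans _ _ (\prod_(j < d) expR (Z * expR (- (gam * (a j - a 0%N)))))).
  apply: ler_prod => j _; rewrite expR_ge1Dx andbT.
  by rewrite addr_ge0 // mulr_ge0 ?expR_ge0 // ltW.
rewrite -expR_sum ler_expR.
apply: (@le_trans _ _ (\sum_(j < d) (Z * (j < J)%N%:R + del))).
  apply: ler_sum => j _; case: (ltnP j J) => jJ.
    rewrite mulr1; apply: (@le_trans _ _ Z); last by rewrite lerDl ltW.
    rewrite ger_pMr // -expR0 ler_expR oppr_le0 mulr_ge0 ?(ltW g0) // subr_ge0.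
    exact: a_nondecreasing.
  by rewrite mulr0 add0r; exact: hJ.
rewrite big_split /= sumr_const card_ord -[del *+ _]mulr_natr lerD2r.
rewrite -mulr_sumr ler_pM2l // -natr_sum ler_nat.
suff -> : (\sum_(j < d) (j < J) = minn d J)%N by exact: geq_minr.
elim: d {B} => [|d ih]; first by rewrite big_ord0 min0n.
by rewrite big_ord_recr /= ih; case: ltnP; lia.
Qed.

(* Averaging over the generators: a frequency not divisible by [N] is dual to
   at most [d] of them, and the others carry a weight below [c / N^2]. *)
Lemma exists_korobov_generator (gam del : R) : 0 < gam -> 0 < del -> exists K : R,
  forall d N, prime N -> exists g : 'I_N, forall B : {fset d.-tuple int},
    \sum_(h <- B | (h != zerot d) && (N %| idot h (korobov_vector d g))%Z)
      weight (2 * gam) h <= expR (K + del * d%:R) / N%:R.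
Proof.
move=> g0 d0.
have d20 : 0 < del / 2 by rewrite divr_gt0.
have [K hK] := sum_weight_le g0 d20.
have [c c0 hc] := @expR_Npowr_le_invsq _ (gam * a 0%N) (inf (range b))
  (mulr_gt0 g0 (a_gt0 _)) b_inf_gt0.
(* The logarithm absorbs the count: [d + c <= (c + 2 / del) exp (del d / 2)], the other half of
   [del] being spent on the sum of weights. *)
exists (K + ln (c + 2 / del)) => d N pN.
have N0 := prime_gt0 pN; have N0R : (0 : R) < N%:R by rewrite ltr0n.
(* One factor is played against the number of dual generators, the other is left to be summed over
   [h]. *)
have w2 (h : d.-tuple int) : weight (2 * gam) h = weight gam h * weight gam h.
  by rewrite /weight -expRD; congr expR; ring.
have w1 (h : d.-tuple int) : weight gam h <= 1.
  by rewrite /weight -expR0 ler_expR oppr_le0 mulr_ge0 ?rho_ge0 ?ltW.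
pose D (g : 'I_N) (h : d.-tuple int) :=
  (h != zerot d) && (N %| idot h (korobov_vector d g))%Z.
have count h : #|[pred g | D g h]|%:R * weight (2 * gam) h
    <= (d%:R + c) * weight gam h.
  rewrite w2 mulrA; apply: ler_wpM2r; first exact: weight_ge0.
  have [h0|h0] := eqVneq h (zerot d).
    have -> : #|[pred g | D g h]| = 0%N.
      by apply: eq_card0 => g; rewrite !inE /D h0 eqxx.
    by rewrite mul0r addr_ge0 // ltW.
  have [[j hj]|hdiv] := pselect (exists j, ~~ (N %| tnth h j)%Z).
    apply: (@le_trans _ _ d%:R); last by rewrite lerDl ltW.
    apply: (@le_trans _ _ (d%:R * 1)); last by rewrite mulr1.
    apply: ler_pM => //; first exact: weight_ge0.
    rewrite ler_nat; apply: leq_trans (card_korobov_dual_le pN (ex_intro _ j hj)).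
    apply: subset_leq_card; apply/fintype.subsetP => g; rewrite !inE => /andP[_].
    by rewrite /idot; under eq_bigr do rewrite tnth_mktuple.
  (* Here [N] divides every coordinate and one is nonzero, hence at least [N] in absolute value; a
     weight of at most [c / N^2] offsets the trivial count [N]. *)
  have [j hj0] : exists j, tnth h j != 0.
    apply/existsP; apply: contraNT h0 => /existsPn hh; apply/eqP/eq_from_tnth => j.
    by rewrite tnth_mktuple; apply/eqP; rewrite -[_ == _]negbK.
  have hjN : (N <= `|tnth h j|)%N.
    have : (N %| tnth h j)%Z by apply/negPn/negP => hn; apply: hdiv; exists j.
    by rewrite dvdzE /= => /dvdn_leq -> //; rewrite absz_gt0.
  have hw : weight gam h <= c / N%:R ^+ 2.
    apply: le_trans (hc N N0); rewrite /weight ler_expR lerN2 -mulrA ler_pM2l //.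
    rewrite /rho (bigD1 j) //= -[leLHS]addr0; apply: lerD; last first.
      by apply: sumr_ge0 => i _; rewrite mulr_ge0 ?powR_ge0 // ltW.
    apply: ler_pM; [exact: ltW|exact: powR_ge0|exact: a_nondecreasing|].
    apply: (@le_trans _ _ (N%:R `^ b j)).
      by apply: ler_powR; [rewrite ler1n|exact: inf_range_le].
    apply: ge0_ler_powR; rewrite ?nnegrE ?(ltW (b_gt0 j)) //.
    by rewrite -abszE -[_%:~R]/(`|tnth h j|%N%:R) ler_nat.
  apply: (@le_trans _ _ (N%:R * (c / N%:R ^+ 2))).
    apply: ler_pM => //; first exact: weight_ge0.
    by rewrite ler_nat; apply: leq_trans (max_card _) _; rewrite card_ord.
  rewrite expr2 invfM !mulrA mulrAC [N%:R * c]mulrC mulfK ?gt_eqF //.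
  apply: (@le_trans _ _ c); last by rewrite lerDr.
  by rewrite ler_pdivrMr // ler_peMr ?(ltW c0) // ler1n.
have [|||g hg] := @exists_le_average R 'I_N _ D (@weight (2 * gam) d) (@weight gam d)
  (d%:R + c) _ _ _ _ count (hK d).
- by rewrite card_ord.
- by move=> h; exact: weight_ge0.
- by rewrite addr_ge0 // ltW.
exists g => B; apply: (le_trans (hg B)); rewrite card_ord.
rewrite ler_pM2r ?invr_gt0 //.
have -> : K + ln (c + 2 / del) + del * d%:R =
  ln (c + 2 / del) + del / 2 * d%:R + (K + del / 2 * d%:R) by field.
rewrite [leRHS]expRD ler_pM2r ?expR_gt0 // expRD lnK ?posrE ?addr_gt0 ?divr_gt0 //.
have h1 := expR_ge1Dx (del / 2 * d%:R).
have h2 : 0 <= del / 2 * d%:R by rewrite mulr_ge0 // ltW.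
rewrite mulrDl addrC; apply: lerD.
  by rewrite ler_peMr ?(ltW c0) //; apply: le_trans h1; rewrite lerDl.
have -> : d%:R = 2 / del * (del / 2 * d%:R) by field; rewrite gt_eqF.
rewrite [X in expR X](_ : _ = del / 2 * d%:R); last by field; rewrite gt_eqF.
rewrite ler_pM2l ?divr_gt0 //; apply: le_trans h1; by rewrite lerDr.
Qed.

End Weights.

(** * Information complexity *)

(** Singletons [B] show that each term is at most [T], so [y_i^(m+1) <= T^m y_i]. *)
Lemma sum_exp_le (R : realDomainType) (I : choiceType) (P : pred I) (y : I -> R)
    (T : R) m : (forall i, 0 <= y i) ->
  (forall B : {fset I}, \sum_(i <- B | P i) y i <= T) ->
  forall B : {fset I}, \sum_(i <- B | P i) y i ^+ m.+1 <= T ^+ m.+1.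
Proof.
move=> y0 hT B.
have T0 : 0 <= T by have := hT fset0; rewrite big_mkcond big_seq_fset0.
have yT i : P i -> y i <= T.
  by move=> Pi; have := hT [fset i]%fset; rewrite big_mkcond big_seq_fset1 Pi.
apply: (@le_trans _ _ (\sum_(i <- B | P i) T ^+ m * y i)).
  apply: ler_sum => i Pi; rewrite exprSr ler_wpM2r //.
  by apply: lerXn2r; rewrite ?nnegrE ?yT.
by rewrite -mulr_sumr exprSr ler_wpM2l // exprn_ge0.
Qed.

(** An arbitrarily small slope suffices, because [C] is negligible against [d + ln (1 / eps)], which
    tends to infinity along the filter. *)
Lemma EXP_WT_of_bound (R : realType) (F : R -> nat -> nat) :
  (forall eta : R, 0 < eta -> exists C, forall eps d, 0 < eps < 1 -> (0 < d)%N ->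
     (0 < F eps d)%N /\ ln (F eps d)%:R <= C + eta * (d%:R + ln eps^-1)) ->
  EXP_WT F.
Proof.
move=> hF; apply/cvgrPdist_le => e e0.
have [C hC] := hF (e / 2) (divr_gt0 e0 (ltr0Sn _ _)).
(* [S] makes [|C| <= e / 2 * S]. Beyond the threshold [S + expR S] one has [d + ln (1 / eps) >= S],
   since otherwise [d <= S] and [1 / eps <= expR S]. *)
pose S := 2 * `|C| / e + 1.
exists (S + expR S) => // -[eps d] /= [eps01 d0 hS].
have [F0 hln] := hC eps d eps01 d0.
have /andP[eps0 eps1] := eps01.
set L := ln eps^-1 in hln *.
have L0 : 0 <= L by rewrite ln_ge0 // invf_ge1 // ltW.
have eL : eps^-1 = expR L by rewrite lnK // posrE invr_gt0.
have dL : S <= d%:R + L.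
  rewrite leNgt; apply/negP => h.
  have : d%:R + eps^-1 <= S + expR S.
    rewrite eL; apply: lerD; last (rewrite ler_expR).
      by apply: le_trans (ltW h); rewrite lerDl.
    by apply: le_trans (ltW h); rewrite lerDr.
  by rewrite leNgt hS.
have S0 : 0 < S by rewrite ltr_wpDl // !mulr_ge0 // invr_ge0 ltW.
have dL0 : 0 < d%:R + L by exact: lt_le_trans S0 dL.
rewrite sub0r normrN ger0_norm; last first.
  by rewrite divr_ge0 ?(ltW dL0) // ln_ge0 // ler1n.
rewrite ler_pdivrMr //; apply: (le_trans hln).
have : C <= e / 2 * (d%:R + L).
  apply: (le_trans (ler_norm C)).
  apply: (@le_trans _ _ (e / 2 * S)); last by rewrite ler_pM2l ?divr_gt0.
  rewrite /S mulrDr mulr1 (_ : e / 2 * (2 * `|C| / e) = `|C|).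
    by rewrite lerDl divr_ge0 // ltW.
  by field; rewrite gt_eqF.
lra.
Qed.

Lemma is_min_exists (A : set nat) n : A n -> exists k, is_min A k.
Proof.
move=> An; have ex : exists n, `[< A n >] by exists n; apply/asboolP.
exists (ex_minn ex); case: ex_minnP => k /asboolP Ak hk; split=> // m Am.
by apply: hk; apply/asboolP.
Qed.

Section Complexity.
Context (R : realType) (a b : nat -> R) (omega : R).

Lemma frac_addz (t : R) (z : int) : Defs.frac (z%:~R + t) = Defs.frac t.
Proof.
rewrite /Defs.frac (_ : Num.floor (z%:~R + t) = z + Num.floor t) ?intrD; first by ring.
apply: floor_def; rewrite -addrA !intrD lerD2l ltrD2l -intrD.
exact: floor_itv.
Qed.

(** Reducing the powers [g ^ j] modulo [N] brings the generating vector into range and changes each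
    [k g^j / N] by an integer, so the nodes are the same. *)
Lemma kor_set_sub_lat_set eps d : kor_set a b omega eps d `<=` lat_set a b omega eps d.
Proof.
move=> N [N0 [g hg]]; split => //.
exists [tuple Ordinal (ltn_pmod (g ^ j) N0) | j < d].
apply: le_trans hg; rewrite /lattice_error.
set x := lattice_points _ _; set x' := lattice_points _ _.
suff -> : x = x' by [].
apply/funext => k; apply: eq_from_tnth => j; rewrite !tnth_mktuple /=.
rewrite [in RHS](divn_eq (g ^ j) N) -[(_ : int)%:~R in RHS]/(_%:R) natrD natrM mulrDr mulrCA.
have N0R : (N%:R : R) != 0 by rewrite pnatr_eq0 -lt0n.
rewrite divfK // -natrM; exact/esym/(frac_addz _ (g ^ j %/ N * k)%N%:Z).
Qed.

Lemma frac_itv (t : R) : 0 <= Defs.frac t < 1.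
Proof.
rewrite /Defs.frac subr_ge0 floor_le /= ltrBlDl.
by have := floorD1_gt t; rewrite intrD.
Qed.

Lemma lat_set_sub_complexity_set eps d :
  lat_set a b omega eps d `<=` complexity_set a b omega eps d.
Proof.
move=> N [N0 [g hg]]; split => //; apply: le_trans hg.
apply: ereal_inf_lbound; eexists (_, _); last reflexivity.
by move=> k j /=; rewrite tnth_mktuple frac_itv.
Qed.

Hypothesis a_gt0 : forall j, 0 < a j.
Hypothesis a_nondecreasing : forall i j, (i <= j)%N -> a i <= a j.
Hypothesis b_gt0 : forall j, 0 < b j.
Hypothesis b_inf_gt0 : 0 < inf (range b).
Hypothesis omega01 : 0 < omega < 1.
Hypothesis a_infty : a @ \oo --> +oo.

Lemma kor_set_bound (eta : R) : 0 < eta -> exists C : R,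
  forall eps d, 0 < eps < 1 -> (0 < d)%N -> exists2 N, kor_set a b omega eps d N &
    ln N%:R <= C + eta * (d%:R + ln eps^-1).
Proof.
move=> eta0; have /andP[omega0 omega1] := omega01.
(* [N] will be at most of order [X ^ 2], which contains [eps^(-4/(m+1))]; this choice makes
   [4 / (m+1) <= eta]. *)
pose m := Num.trunc (4 / eta).
have m0 : (0 : R) < m.+1%:R by rewrite ltr0n.
have hm : 4 / m.+1%:R <= eta.
  by rewrite ler_pdivrMr // mulrC -ler_pdivrMr //; exact/ltW/truncnS_gt.
pose L := - ln omega.
have L0 : 0 < L by rewrite oppr_gt0 ln_lt0 // omega0.
(* With this [gam], the power [m+1] of [weight (2 * gam) h] is [omega^rho]. *)
pose gam := L / (2 * m.+1%:R).
have g0 : 0 < gam by rewrite divr_gt0 // mulr_gt0.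
have eta20 : 0 < eta / 2 by rewrite divr_gt0.
have [K hK] := exists_korobov_generator a_gt0 a_nondecreasing b_gt0 b_inf_gt0
  a_infty g0 eta20.
(* [128 = 32 * 2^2], from [N <= 32 M^2] and [M <= 2 X]. *)
exists (ln 128 + 2 * `|K|) => eps d eps01 d0.
have /andP[eps0 eps1] := eps01.
set Lam := ln eps^-1.
have Lam0 : 0 <= Lam by rewrite ln_ge0 // invf_ge1 // ltW.
have eLam : eps = expR (- Lam) by rewrite expRN lnK ?invrK // posrE invr_gt0.
(* [N >= expR E] brings the bound [T] on the dual sum below [eps^(2/(m+1))], whose power [m+1] is
   [eps^2]; the absolute value of [K] ensures [E >= 0]. *)
pose E := `|K| + eta / 2 * d%:R + 2 * Lam / m.+1%:R.
pose X := expR E.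
have E0 : 0 <= E.
  by rewrite !addr_ge0 // ?divr_ge0 ?mulr_ge0 ?divr_ge0 // ltW.
have X1 : 1 <= X by rewrite -expR0 ler_expR.
pose M := (Num.trunc X).+1.
have XM : X < M%:R by exact: truncnS_gt.
have MX : M%:R <= 2 * X.
  have /andP[h _] := truncn_itv (le_trans ler01 X1).
  by rewrite /M -natr1; lra.
have [N pN /andP[MN NM]] := exists_prime_between (ltn0Sn (Num.trunc X)).
have N0 := prime_gt0 pN; have N0R : (0 : R) < N%:R by rewrite ltr0n.
have XN : X <= N%:R by apply: (le_trans (ltW XM)); rewrite ler_nat ltnW.
exists N; last first.
  have N128 : N%:R <= 128 * X ^+ 2.
    apply: (@le_trans _ _ (32 * M%:R ^+ 2)); first by rewrite -natrX -natrM ler_nat.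
    rewrite [128 * _](_ : _ = 32 * (2 * X) ^+ 2); last by ring.
    rewrite ler_pM2l //; apply: lerXn2r; rewrite ?nnegrE //.
    by rewrite mulr_ge0 // expR_ge0.
  apply: (@le_trans _ _ (ln (128 * X ^+ 2))).
    by rewrite ler_ln ?posrE // mulr_gt0 ?exprn_gt0 ?expR_gt0.
  rewrite lnM ?posrE ?exprn_gt0 ?expR_gt0 // -addrA lerD2l.
  rewrite -expRM_natl expRK /E.
  have h4 : 4 / m.+1%:R * Lam <= eta * Lam by rewrite ler_wpM2r.
  rewrite [leLHS](_ : _ = 2 * `|K| + (eta * d%:R + 4 / m.+1%:R * Lam)).
    by rewrite lerD2l mulrDr lerD2l.
  by field; rewrite gt_eqF.
have [g hg] := hK d N pN.
split=> //; exists g; apply: lattice_error_le => // B.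
set T := expR (K + eta / 2 * d%:R) / N%:R in hg.
apply: (@le_trans _ _ (T ^+ m.+1)).
  have := sum_exp_le m (fun h => weight_ge0 _ _ _ h) hg.
  move=> /(_ B); congr (_ <= _); apply: eq_bigr => h _.
  rewrite /weight -expRM_natl /powR gt_eqF //; congr expR.
  by rewrite /gam /L; field; rewrite gt_eqF.
have T0 : 0 <= T by rewrite divr_ge0 ?expR_ge0.
apply: (@le_trans _ _ (expR (- (2 * Lam / m.+1%:R)) ^+ m.+1)).
  apply: lerXn2r; rewrite ?nnegrE ?expR_ge0 // /T ler_pdivrMr //.
  apply: (@le_trans _ _ (expR (- (2 * Lam / m.+1%:R)) * X)); last first.
    by rewrite ler_pM2l ?expR_gt0.
  by rewrite /X -expRD ler_expR /E addrCA addNr addr0 lerD2r ler_norm.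
rewrite -expRM_natl eLam -expRM_natl ler_expR.
rewrite le_eqVlt; apply/orP; left; apply/eqP; field.
by rewrite gt_eqF.
Qed.

End Complexity.

Theorem mainTheorem1 (R : realType) (a b : nat -> R) (omega : R)
    (a_gt0 : forall j, 0 < a j)
    (a_nondecreasing : forall i j, (i <= j)%N -> a i <= a j)
    (b_gt0 : forall j, 0 < b j)
    (b_inf_gt0 : 0 < inf (range b))
    (omega01 : 0 < omega < 1)
    (a_infty : a @ \oo --> +oo) :
  exists Nlat Nkor Ninf : R -> nat -> nat,
    (forall (eps : R) (d : nat), 0 < eps < 1 -> (0 < d)%N ->
       [/\ is_min (lat_set a b omega eps d) (Nlat eps d),
           is_min (kor_set a b omega eps d) (Nkor eps d)
         & is_min (complexity_set a b omega eps d) (Ninf eps d)]) /\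
    [/\ EXP_WT Nlat, EXP_WT Nkor & EXP_WT Ninf].
Proof.
have bound := kor_set_bound a_gt0 a_nondecreasing b_gt0 b_inf_gt0 omega01 a_infty.
(* The default 0 is taken only when no minimum exists, which does not happen for [eps] in [(0,1)],
   [d > 0] and [S] containing the Korobov set. *)
pose mn (S : R -> nat -> set nat) eps d := xget 0%N [set n | is_min (S eps d) n].
have mnP (S : R -> nat -> set nat) eps d :
    kor_set a b omega eps d `<=` S eps d -> 0 < eps < 1 -> (0 < d)%N ->
    is_min (S eps d) (mn S eps d).
  move=> sub eps01 d0; have [C /(_ _ _ eps01 d0)[n hn _]] := bound 1 ltr01.
  have [k hk] := is_min_exists (sub _ hn).
  exact: (@xgetPex _ 0%N [set n | is_min (S eps d) n] (ex_intro _ k hk)).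
(* Each of the three sets contains the Korobov one, so its minimum is at most the Korobov [N] given
   by [bound]. *)
have mnWT (S : R -> nat -> set nat) :
    (forall eps d, kor_set a b omega eps d `<=` S eps d) ->
    (forall eps d, S eps d `<=` [set n | (0 < n)%N]) -> EXP_WT (mn S).
  move=> sub pos; apply: EXP_WT_of_bound => eta eta0.
  have [C hC] := bound eta eta0; exists C => eps d eps01 d0.
  have [n hn hln] := hC eps d eps01 d0.
  have [Smn min] := mnP S eps d (sub _ _) eps01 d0.
  have mn0 := pos _ _ _ Smn; split => //; apply: le_trans hln.
  have lemn := min n (sub _ _ _ hn).
  by rewrite ler_ln ?posrE ?ltr0n ?ler_nat // (leq_trans mn0).
have kl eps d := @kor_set_sub_lat_set R a b omega eps d.
have kc eps d := subset_trans (kl eps d) (@lat_set_sub_complexity_set R a b omega eps d).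
exists (mn (lat_set a b omega)), (mn (kor_set a b omega)), (mn (complexity_set a b omega)).
split; first by move=> eps d eps01 d0; split; apply: mnP => //.
by split; apply: mnWT => // eps d n [].
Qed.
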